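(* Suppose $\mathcal{L}_c$ is a distribution on $\mathbb{R}^d$ with mean and covariance pair $(\mu,A)$. Assume that $A$ is finite and invertible. Consider the covariance norm $\|x-\mu\|_{\mathcal{L}_c}$, where $x$ may be drawn from $\mathcal{L}_c$, or drawn from an unknown distribution $\mathcal{L}_u$ on $\mathbb{R}^d$ with mean and covariance pair $(\mu_u,A_u)$. Assume that $$\sqrt{d}\ \ll\ \frac{\big|A^{-1/2}(\mu-\mu_u)\big|}{\big\|A^{-1/2}A_u^{1/2}\big\|}.$$ Then for a predetermined $\delta\in\big(\sqrt{d},\,|A^{-1/2}(\mu-\mu_u)|\big)$ such that $$\sqrt{d}\ \ll\ \min\left(\delta,\ \frac{\big|A^{-1/2}(\mu-\mu_u)\big|-\delta}{\big\|A^{-1/2}A_u^{1/2}\big\|}\right),$$ it holds that $$\mathbb{P}\left(\|x-\mu\|_{\mathcal{L}_c}>\delta \mid x\sim\mathcal{L}_c\right)\le \frac{d}{\delta^2}$$ and $$\mathbb{P}\left(\|x-\mu\|_{\mathcal{L}_c}<\delta \mid x\sim\mathcal{L}_u\right)\le \frac{d\,\big\|A^{-1/2}A_u^{1/2}\big\|^2}{\big(|A^{-1/2}(\mu_u-\mu)|-\delta\big)^2}.$$ In particular, when $\delta=\dfrac{|A^{-1/2}(\mu_u-\mu)|}{1+\|A^{-1/2}A_u^{1/2}\|}$, $$\mathbb{P}\left(\|x-\mu\|_{\mathcal{L}_c}<\delta \mid x\sim\mathcal{L}_u\right)\le \frac{d}{\delta^2}.$$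
   Context: The relation $a\ll b$ means ''$a$ is much smaller than $b$''; it is used informally, with no specific constant attached. $|\cdot|$ is the Euclidean norm on $\mathbb{R}^d$ and $\|B\|$ is the matrix operator norm of a matrix $B$. $A^{-1/2}$ is the inverse of the symmetric positive definite square root of $A$, and $A_u^{1/2}$ is the symmetric positive semidefinite square root of $A_u$. The covariance norm associated with $\mathcal{L}_c$ (mean $\mu$, invertible covariance $A$), evaluated at $x-\mu$, is $\|x-\mu\|_{\mathcal{L}_c}=\sqrt{(x-\mu)^T A^{-1}(x-\mu)}=|A^{-1/2}(x-\mu)|$. The notation $\mathbb{P}(\cdot\mid x\sim\mathcal{L})$ means the probability when the random vector $x$ has distribution $\mathcal{L}$. The two bounds control the Type-I (false positive) and Type-II (false negative) errors of the anomaly test that flags $x$ when its covariance norm exceeds $\delta$. *)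

(* Defs.v *)
From HB Require Import structures.
From mathcomp Require Import all_boot all_order all_algebra.
From mathcomp Require Import all_classical all_reals all_analysis.

Set Implicit Arguments.
Unset Strict Implicit.
Unset Printing Implicit Defensive.

Import Order.TTheory GRing.Theory Num.Theory.
Import numFieldNormedType.Exports.

Local Open Scope classical_set_scope.
Local Open Scope ring_scope.

Notation borel_cV R d := (g_sigma_algebraType (@open 'cV[R]_d)).

Section LinearAlgebra.
Context {R : realType} {d : nat}.
Implicit Types (v : 'cV[R]_d) (A B S : 'M[R]_d).

(* The library norm `|v| on matrices is the sup norm. *)
Definition enorm v : R := Num.sqrt (\sum_i v i 0 ^+ 2).

Definition opnorm B : R := sup [set enorm (B *m v) | v in [set v | enorm v <= 1]].

Definition psdmx S : Prop :=
  S^T = S /\ forall v, 0 <= (v^T *m S *m v) 0 0.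

(* A^{1/2}. A positive semidefinite A has exactly one positive semidefinite
   square root, which is positive definite when A is invertible. If A is not
   positive semidefinite (never the case for a covariance matrix), the value is
   unspecified. *)
Definition sqrtmx A : 'M[R]_d := get [set S | psdmx S /\ S *m S = A].

Definition invsqrtmx A : 'M[R]_d := invmx (sqrtmx A).

Definition covnorm A v : R := Num.sqrt ((v^T *m invmx A *m v) 0 0).

End LinearAlgebra.

Section MeanCovariance.
Context {R : realType} {d : nat}.

Definition component (i : 'I_d) (x : borel_cV R d) : R := (x : 'cV[R]_d) i 0.

(* Without square integrability the integrals defining the mean and the
   covariance could take meaningless default values. *)
Definition has_mean_cov (L : probability (borel_cV R d) R)
    (mu : 'cV[R]_d) (A : 'M[R]_d) : Prop :=
  [/\ forall i, component i \in Lfun L 2%:E,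
      forall i, 'E_L[component i]%E = (mu i 0)%:E &
      forall i j, covariance L (component i) (component j) = (A i j)%:E].

End MeanCovariance.

(* Main.v *)
(* Write V = A^{-1/2} and T = A_u^{1/2}. If x has mean m and covariance S, then
   E[(x - m)^T B (x - m)] = tr(B S) for every matrix B. With B = A^{-1} and
   Markov's inequality, the first bound follows from tr(A^{-1} A) = d. For the
   second one, |V(x - mu)| < delta forces |V(x - mu_u)| > |V(mu_u - mu)| - delta,
   and tr(A^{-1} A_u) = |VT|_F^2 <= d |VT|^2.

   The square root of a positive semidefinite A is Q^2 with Q = q(A), where the
   real polynomial q interpolates the fourth root on the spectrum of A. Hence the
   complex spectral theorem suffices: Q is real and symmetric, and Q^2 is positive
   semidefinite, by construction. *)
Require Import Defs.
From HB Require Import structures.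
From mathcomp Require Import all_boot all_order all_algebra.
From mathcomp Require Import complex.
From mathcomp Require Import all_classical all_reals all_analysis.
From mathcomp Require Import measurable_realfun ring.

Set Implicit Arguments.
Unset Strict Implicit.
Unset Printing Implicit Defensive.

Import Order.TTheory GRing.Theory Num.Theory.
Import numFieldNormedType.Exports.

Local Open Scope classical_set_scope.
Local Open Scope ring_scope.

(** * Polynomial interpolation and polynomials of matrices *)

(** Newton's scheme: a new node [a] is handled by adding a multiple of [w], which vanishes on the
    earlier nodes and not at [a]. *)
Lemma interpolation_exists (F : fieldType) (s : seq F) (f : F -> F) :
  exists q : {poly F}, forall x, x \in s -> q.[x] = f x.
Proof.
elim: s => [|a s [q qP]]; first by exists 0.
have [as_|as_] := boolP (a \in s).
  by exists q => x; rewrite inE => /predU1P[->|]; exact: qP.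
pose w : {poly F} := \prod_(b <- s) ('X - b%:P).
have wa : w.[a] != 0 by rewrite -[_ == 0]/(root w a) root_prod_XsubC.
exists (q + ((f a - q.[a]) / w.[a]) *: w) => x.
rewrite inE !hornerE => /predU1P[->|xs]; first by rewrite divfK// subrKC.
have /eqP -> : root w x by rewrite root_prod_XsubC.
by rewrite mulr0 addr0 qP.
Qed.

Lemma trmx_horner_mx (R : comNzRingType) n (A : 'M[R]_n.+1) (p : {poly R}) :
  (horner_mx A p)^T = horner_mx A^T p.
Proof.
elim/poly_ind: p => [|p c IHp]; first by rewrite !rmorph0 trmx0.
rewrite !rmorphD !rmorphM /= !horner_mx_X !horner_mx_C linearD /= -!mulmxE.
by rewrite trmx_mul IHp tr_scalar_mx (comm_mx_horner _ (erefl _)).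
Qed.

(** * Symmetric matrices and their square roots *)

Section LinearAlgebra.
Context {R : realType}.
Local Notation toC := (map_mx (real_complex R)).

Lemma dotE d (u v : 'cV[R]_d) : (u^T *m v) 0 0 = \sum_i u i 0 * v i 0.
Proof. by rewrite mxE; apply: eq_bigr => i _; rewrite mxE. Qed.

(** A row eigenvector [v] gives v A v^T = l |v|^2, where |v|^2 > 0. *)
Lemma eigenvalue_psd_ge0 d (A : 'M[R]_d) l :
  psdmx A -> eigenvalue A l -> 0 <= l.
Proof.
move=> [Asym Apos] /eigenvalueP[v vA v0].
have := Apos v^T; rewrite trmxK vA -scalemxAl mxE.
rewrite -{1}[v]trmxK dotE pmulr_lge0//.
rewrite lt_def sumr_ge0 ?andbT => [|i _]; last by rewrite -expr2 sqr_ge0.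
apply: contraNneq v0 => /eqP; rewrite psumr_eq0 => [|i _]; last first.
  by rewrite -expr2 sqr_ge0.
move=> /allP v0; apply/eqP/rowP => i; have := v0 i; rewrite mem_index_enum.
by move=> /(_ isT); rewrite -expr2 sqrf_eq0 !mxE => /eqP.
Qed.

(** Over the complex numbers [A] is Hermitian, so the spectral theorem applies and the diagonal is
    real. Only the change of basis [P] stays complex. *)
Lemma symmetric_diagonalizable d (A : 'M[R]_d) : A^T = A ->
  exists (l : 'rV[R]_d) (P : 'M[R[i]]_d),
    [/\ P \in unitmx, toC A = invmx P *m diag_mx (toC l) *m P &
        forall i, eigenvalue A (l 0 i)].
Proof.
move=> Asym; pose C : numClosedFieldType := R[i].
pose AC : 'M[C]_d := toC A.
have herm : AC \is hermsymmx.
  apply: realsym_hermsym.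
    by apply/is_hermitianmxP; rewrite expr0 scale1r map_mx_id// map_trmx Asym.
  by apply/mxOverP => i j; rewrite mxE; apply/complex_realP; exists (A i j).
have /mxOverP real := hermitian_spectral_diag_real herm.
have /orthomx_spectralP/= spec := hermitian_normalmx herm.
have Pu := spectral_unit AC.
exists (map_mx (@complex.Re R) (spectral_diag AC)), (spectralmx AC).
have lE : toC (map_mx (@complex.Re R) (spectral_diag AC)) = spectral_diag AC.
  by apply/rowP => i; rewrite !mxE; apply: RRe_real; exact: real.
rewrite lE; split => // i.
(* Being an eigenvalue is unaffected by the field extension, so a complex eigenvector is enough: row
   [i] of the spectral matrix, nonzero because that matrix is invertible. *)
rewrite -(eigenvalue_map (real_complex R)); apply/eigenvalueP.
exists (row i (spectralmx AC)).
  rewrite -row_mul -/AC {2}spec 2!mulmxA mulmxV// mul1mx -lE row_mul row_diag_mx.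
  by rewrite -scalemxAl -rowE !mxE.
apply/eqP => r0; have := mulmxK Pu (delta_mx 0 i : 'rV_d).
rewrite -rowE r0 mul0mx => /rowP/(_ i)/eqP.
by rewrite !mxE !eqxx eq_sym oner_eq0.
Qed.

Lemma psd_sqrt_exists d (A : 'M[R]_d) :
  psdmx A -> exists S, psdmx S /\ S *m S = A.
Proof.
(* [horner_mx] needs a matrix of positive size, so dimension 0 is treated apart. *)
case: d A => [|d] A Apsd.
  by exists 0; split; [move: Apsd|]; rewrite [A]flatmx0 ?mulmx0.
have [Asym _] := Apsd.
have [l [P [Pu Aeq leig]]] := symmetric_diagonalizable Asym.
have l0 i : 0 <= l 0 i by exact: eigenvalue_psd_ge0 (leig i).
have [q qP] := interpolation_exists [seq l 0 i | i : 'I_d.+1]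
                 (fun x => Num.sqrt (Num.sqrt x)).
pose Q := horner_mx A q.
have Qsym : Q^T = Q by rewrite trmx_horner_mx Asym.
exists (Q *m Q); split.
  split; first by rewrite trmx_mul Qsym.
  move=> v; rewrite -{1}Qsym mulmxA -trmx_mul -mulmxA dotE sumr_ge0// => i _.
  by rewrite -expr2 sqr_ge0.
have -> : Q *m Q *m (Q *m Q) = horner_mx A (q ^+ 4).
  by rewrite rmorphXn /= !exprS expr0 mulr1 -!mulmxE !mulmxA.
(* The identity q(A)^4 = A is checked over the complex numbers, where [A] is diagonalized and it
   reduces to q(l)^4 = l for each eigenvalue [l]. *)
apply: (map_mx_inj (f := real_complex R)).
rewrite map_horner_mx /= Aeq horner_mx_uconjC// horner_mx_diag.
congr (_ *m diag_mx _ *m _); apply/rowP => i; rewrite !mxE.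
rewrite horner_map /= horner_exp qP; last first.
  by apply/mapP; exists i; rewrite ?mem_enum.
by rewrite (exprM _ 2 2) !sqr_sqrtr ?sqrtr_ge0.
Qed.

Lemma sqrtmxP d (A : 'M[R]_d) :
  psdmx A -> psdmx (sqrtmx A) /\ sqrtmx A *m sqrtmx A = A.
Proof. by move=> /psd_sqrt_exists/getPex. Qed.

Lemma invsqrtmx_sym d (A : 'M[R]_d) : psdmx A -> (invsqrtmx A)^T = invsqrtmx A.
Proof. by move=> /sqrtmxP[[Ssym _] _]; rewrite trmx_inv Ssym. Qed.

Lemma invsqrtmx_sqr d (A : 'M[R]_d) : psdmx A -> A \in unitmx ->
  invsqrtmx A *m invsqrtmx A = invmx A.
Proof.
move=> /sqrtmxP[_ SS] Au; have Su : sqrtmx A \in unitmx.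
  by move: Au; rewrite -{1}SS unitmx_mul => /andP[].
suff VVA : invsqrtmx A *m invsqrtmx A *m A = 1%:M.
  by rewrite -[LHS](mulmxK Au) VVA mul1mx.
by rewrite -[X in _ *m X = _]SS mulmxA mulmxKV// mulVmx.
Qed.

(** * Euclidean and operator norms *)

Lemma enorm_ge0 d (v : 'cV[R]_d) : 0 <= enorm v.
Proof. exact: sqrtr_ge0. Qed.

Lemma sqr_enorm d (v : 'cV[R]_d) : enorm v ^+ 2 = \sum_i v i 0 ^+ 2.
Proof. by rewrite sqr_sqrtr// sumr_ge0// => i _; rewrite sqr_ge0. Qed.

Lemma enormN d (v : 'cV[R]_d) : enorm (- v) = enorm v.
Proof.
by congr Num.sqrt; apply: eq_bigr => i _; rewrite mxE sqrrN.
Qed.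

(** With b = <u, v>, a = |u| and c = |v|, the squared norm of c^2 u - b v equals c^2 ((a c)^2 -
    b^2). Its nonnegativity yields the claim once c^2 > 0 is cancelled. *)
Lemma cauchy_schwarz d (u v : 'cV[R]_d) :
  \sum_i u i 0 * v i 0 <= enorm u * enorm v.
Proof.
set b := \sum_i _; set a := enorm u; set c := enorm v.
have bE : \sum_i u i 0 * v i 0 = b by [].
have [c0|c0] := eqVneq c 0.
  rewrite c0 mulr0 /b big1// => i _.
  have /eqP : \sum_i v i 0 ^+ 2 = 0 by rewrite -sqr_enorm -/c c0 expr0n.
  rewrite psumr_eq0 => [|j _]; last exact: sqr_ge0.
  by move=> /allP/(_ i); rewrite mem_index_enum sqrf_eq0 => /(_ isT)/eqP->;
    rewrite mulr0.
have cp : 0 < c by rewrite lt_def c0 enorm_ge0.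
have : 0 <= \sum_i (c ^+ 2 * u i 0 - b * v i 0) ^+ 2.
  by rewrite sumr_ge0// => i _; rewrite sqr_ge0.
have -> : \sum_i (c ^+ 2 * u i 0 - b * v i 0) ^+ 2
    = c ^+ 2 * ((a * c) ^+ 2 - b ^+ 2).
  clearbody b; transitivity (c ^+ 4 * \sum_i u i 0 ^+ 2
      - c ^+ 2 * b *+ 2 * \sum_i u i 0 * v i 0
      + b ^+ 2 * \sum_i v i 0 ^+ 2).
    rewrite !mulr_sumr -sumrB -big_split/=; apply: eq_bigr => i _; ring.
  rewrite bE -!sqr_enorm -/a -/c; ring.
rewrite pmulr_rge0 ?exprn_gt0// subr_ge0 => bac.
have ac0 : 0 <= a * c by rewrite mulr_ge0 ?enorm_ge0.
apply: le_trans (ler_norm b) _.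
by rewrite -(ger0_norm ac0) -!sqrtr_sqr ler_wsqrtr.
Qed.

Lemma ler_enormD d (u v : 'cV[R]_d) : enorm (u + v) <= enorm u + enorm v.
Proof.
rewrite -(@ler_pXn2r _ 2) ?nnegrE ?addr_ge0 ?enorm_ge0//.
rewrite sqrrD !sqr_enorm (eq_bigr (fun i =>
  u i 0 ^+ 2 + (u i 0 * v i 0) *+ 2 + v i 0 ^+ 2)); last first.
  by move=> i _; rewrite mxE sqrrD.
rewrite 2!big_split/= sumrMnl lerD2r lerD2l lerMn2r/=.
exact: cauchy_schwarz.
Qed.

Lemma invmx_formE d (A : 'M[R]_d) (v : 'cV[R]_d) : psdmx A -> A \in unitmx ->
  (v^T *m invmx A *m v) 0 0 = enorm (invsqrtmx A *m v) ^+ 2.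
Proof.
move=> Apsd Au; rewrite sqr_enorm -invsqrtmx_sqr// mulmxA -mulmxA.
rewrite -{1}(invsqrtmx_sym Apsd) -trmx_mul dotE.
by apply: eq_bigr => i _; rewrite expr2.
Qed.

Lemma covnormE d (A : 'M[R]_d) (v : 'cV[R]_d) : psdmx A -> A \in unitmx ->
  covnorm A v = enorm (invsqrtmx A *m v).
Proof.
by move=> Apsd Au; rewrite /covnorm invmx_formE// sqrtr_sqr ger0_norm ?enorm_ge0.
Qed.

Lemma opnorm_ub d (B : 'M[R]_d) (v : 'cV[R]_d) :
  enorm v <= 1 -> enorm (B *m v) <= opnorm B.
Proof.
move=> v1; apply: ub_le_sup; last by exists v.
(* A [sup] dominates its set only if the set is bounded; the sum of the absolute values of all
   entries is a crude bound. *)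
exists (\sum_i \sum_j `|B i j|) => _ [w w1 <-].
have wi1 i : `|w i 0| <= 1.
  apply: le_trans w1; rewrite -sqrtr_sqr ler_wsqrtr// (bigD1 i)//= lerDl.
  by rewrite sumr_ge0// => j _; rewrite sqr_ge0.
have S0 i : 0 <= \sum_j `|B i j| by rewrite sumr_ge0.
rewrite -[leRHS]ger0_norm ?sumr_ge0// -sqrtr_sqr ler_wsqrtr//.
(* Coordinates of [w] are at most 1 in absolute value, so those of [B *m w] are bounded by the
   absolute row sums; the sum of squares of these is at most the square of their sum. *)
apply: (@le_trans _ _ (\sum_i (\sum_j `|B i j|) ^+ 2)).
  apply: ler_sum => i _; rewrite -real_normK ?num_real// lerXn2r ?nnegrE//.
  rewrite mxE (le_trans (ler_norm_sum _ _ _))//; apply: ler_sum => j _.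
  by rewrite normrM ler_piMr.
rewrite [leRHS]expr2 mulr_suml; apply: ler_sum => i _.
by rewrite expr2 ler_wpM2l// [leRHS](bigD1 i)//= lerDl sumr_ge0.
Qed.

(** The trace is the sum of the squared norms of the [d] columns of [B], each the image of a unit
    vector. *)
Lemma frobenius_le_opnorm d (B : 'M[R]_d) :
  \tr (B *m B^T) <= d%:R * opnorm B ^+ 2.
Proof.
have -> : \tr (B *m B^T) = \sum_j enorm (B *m delta_mx j 0) ^+ 2.
  rewrite /mxtrace (eq_bigr (fun i => \sum_j B i j ^+ 2)); last first.
    by move=> i _; rewrite mxE; apply: eq_bigr => j _; rewrite mxE expr2.
  rewrite exchange_big; apply: eq_bigr => j _; rewrite sqr_enorm.
  by apply: eq_bigr => i _; rewrite -colE mxE.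
rewrite -[X in X%:R]card_ord mulr_natl -sumr_const; apply: ler_sum => j _.
have Bj : enorm (B *m delta_mx j 0) <= opnorm B.
  apply: opnorm_ub; rewrite /enorm (bigD1 j)//= big1 => [|i ij].
    by rewrite mxE !eqxx expr1n addr0 sqrtr1.
  by rewrite mxE (negbTE ij) expr0n.
by rewrite lerXn2r ?nnegrE ?enorm_ge0// (le_trans _ Bj) ?enorm_ge0.
Qed.

Lemma opnorm_ge0 d (B : 'M[R]_d) : 0 <= opnorm B.
Proof.
apply: le_trans (enorm_ge0 _) (opnorm_ub (v := 0) _ _).
by rewrite /enorm big1 ?sqrtr0// => i _; rewrite mxE expr0n.
Qed.

End LinearAlgebra.

(** * Measurable events and quadratic forms of a random vector *)

Lemma measurable_ler_set disp (T : measurableType disp) (R : realType)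
    (f g : T -> R) :
  measurable_fun setT f -> measurable_fun setT g ->
  measurable [set x | f x <= g x].
Proof.
by move=> mf mg; rewrite -[X in measurable X]setTI; exact: measurable_fun_le.
Qed.

Lemma measurable_ltr_set disp (T : measurableType disp) (R : realType)
    (f g : T -> R) :
  measurable_fun setT f -> measurable_fun setT g ->
  measurable [set x | f x < g x].
Proof.
move=> mf mg; rewrite (_ : mkset _ = ~` [set x | g x <= f x]).
  exact/measurableC/measurable_ler_set.
by apply/seteqP; split => x /=; rewrite real_ltNge ?num_real// => /negP.
Qed.

Section QuadraticForm.
Context {R : realType} {d : nat}.

Definition centered (mu : 'cV[R]_d) (i : 'I_d) (x : borel_cV R d) : R :=
  (x : 'cV[R]_d) i 0 - mu i 0.

Definition centered_form (mu : 'cV[R]_d) (B : 'M[R]_d) (x : borel_cV R d) : R :=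
  (((x : 'cV[R]_d) - mu)^T *m B *m (x - mu)) 0 0.

End QuadraticForm.

Section Probability.
Context {R : realType} {d : nat}.
Context {L : probability (borel_cV R d) R} {mu : 'cV[R]_d} {A : 'M[R]_d}.
Context (LmA : has_mean_cov L mu A).

Lemma covariance_matrix_sym : A^T = A.
Proof.
case: LmA => _ _ cov; apply/matrixP => i j; rewrite mxE; apply: EFin_inj.
by rewrite -!cov covarianceC.
Qed.

Let centered_Lfun2 i : centered mu i \in Lfun L 2%:E.
Proof.
case: LmA => L2 _ _; rewrite (_ : centered mu i = component i - cst (mu i 0))//.
by rewrite rpredB ?lee1n//= => *; rewrite Lfun_cst.
Qed.

Let centered_mul_Lfun1 i j : centered mu i * centered mu j \in Lfun L 1.
Proof. exact: Lfun2_mul_Lfun1. Qed.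

Let expectation_centered_mul i j :
  ('E_L[centered mu i * centered mu j])%E = (A i j)%:E.
Proof. by case: LmA => _ m <-; rewrite covariance.unlock !m. Qed.

(** A sum over a list of functions is the shape that [expectation_sum] takes. *)
Let centered_formE B : centered_form mu B =
  \sum_(f <- [seq B p.1 p.2 \o* (centered mu p.1 * centered mu p.2)
                 | p : 'I_d * 'I_d]) f.
Proof.
apply/funext => x; rewrite big_image/= fct_sumE /centered_form mxE.
under eq_bigr do rewrite mxE mulr_suml.
rewrite exchange_big pair_big/=; apply: eq_bigr => -[i j] _ /=.
by rewrite mulrfctE !mxE /centered/=; ring.
Qed.

Let centered_form_Lfun1 B : centered_form mu B \in Lfun L 1.
Proof.
rewrite centered_formE big_image/=; apply: rpred_sum => -[i j] _ /=.
by rewrite Lfun_scale//; exact: centered_mul_Lfun1.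
Qed.

Lemma expectation_quadratic_form B :
  ('E_L[centered_form mu B])%E = (\tr (B *m A))%:E.
Proof.
rewrite centered_formE expectation_sum; last first.
  by move=> _ /mapP[[i j] _ ->]; rewrite Lfun_scale//; exact: centered_mul_Lfun1.
rewrite big_image/= /mxtrace -sumEFin.
under [RHS]eq_bigr do rewrite mxE -sumEFin.
rewrite pair_big; apply: eq_bigr => -[i j] _ /=.
rewrite expectationZl// expectation_centered_mul.
(* The expansion pairs [B i j] with [A i j], the trace with [A j i]; symmetry of [A] reconciles
   them. *)
by rewrite -[in RHS]covariance_matrix_sym mxE.
Qed.

Lemma measurable_centered_form B : measurable_fun setT (centered_form mu B).
Proof. by have := centered_form_Lfun1 B; rewrite inE => /andP[/[!inE]]. Qed.

(** v^T A v = tr(v v^T A) is the expectation of the square of v^T (x - mu). *)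
Lemma covariance_matrix_psd : psdmx A.
Proof.
split; first exact: covariance_matrix_sym.
move=> v; have -> : (v^T *m A *m v) 0 0 = \tr (v *m v^T *m A).
  by rewrite -trace_mx11 mxtrace_mulC mulmxA.
rewrite -lee_fin -expectation_quadratic_form expectation_ge0// => x.
rewrite /centered_form mulmxA -mulmxA.
rewrite -[X in X *m (_ *m _)]trmxK trmx_mul trmxK dotE sumr_ge0// => i _.
by rewrite -expr2 sqr_ge0.
Qed.

Lemma markov_quadratic_form B (t : R) :
    (forall v : 'cV[R]_d, 0 <= (v^T *m B *m v) 0 0) ->
  0 < t -> (L [set x | (t <= centered_form mu B x)%R] <= (\tr (B *m A) / t)%:E)%E.
Proof.
move=> B0 t0.
have q0 x : 0 <= centered_form mu B x by exact: B0.
have mq : centered_form mu B \in mfun.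
  by rewrite inE; exact: measurable_centered_form.
(* Markov's inequality concerns the absolute value of the variable, which is the form itself by
   [q0]. *)
have := @markov _ _ R L (mfun_Sub mq) id t t0 (@measurable_id _ _ _)
  (fun _ => id) (fun _ _ _ _ => id).
rewrite mulrC EFinM lee_pdivlMl// -expectation_quadratic_form.
under eq_set do rewrite /= lee_fin ger0_norm//.
rewrite (_ : _ \o _ = centered_form mu B)//; apply/funext => x /=.
by rewrite ger0_norm.
Qed.

Lemma measurable_covnorm (B : 'M[R]_d) :
  measurable_fun setT (fun x : borel_cV R d => covnorm B ((x : 'cV[R]_d) - mu)).
Proof.
have msqrt := continuous_measurable_fun (@sqrt_continuous R).
exact: measurableT_comp msqrt (measurable_centered_form (invmx B)).
Qed.

End Probability.

(* The informal relation "much smaller than" is an arbitrary relation ll on the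
   extended reals of which only ll a b -> a < b is assumed. The quotients in its
   arguments are extended-real, so that a positive number divided by 0 is +oo:
   the operator norm in the denominator vanishes when A_u = 0. *)
Theorem proposition2p4 (R : realType) (d : nat)
  (ll : \bar R -> \bar R -> Prop)
  (ll_lt : forall a b : \bar R, ll a b -> (a < b)%E)
  (L_c : probability (borel_cV R d) R) (mu : 'cV[R]_d) (A : 'M[R]_d)
  (L_u : probability (borel_cV R d) R) (mu_u : 'cV[R]_d) (A_u : 'M[R]_d)
  (L_c_mean_cov : has_mean_cov L_c mu A)
  (A_inv : A \in unitmx)
  (L_u_mean_cov : has_mean_cov L_u mu_u A_u)
  (gap : ll (Num.sqrt d%:R)%:E
            ((enorm (invsqrtmx A *m (mu - mu_u)))%:E
             / (opnorm (invsqrtmx A *m sqrtmx A_u))%:E)%E)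
  (delta : R)
  (delta_range :
     Num.sqrt d%:R < delta < enorm (invsqrtmx A *m (mu - mu_u)))
  (delta_gap :
     ll (Num.sqrt d%:R)%:E
        (Order.min delta%:E
           ((enorm (invsqrtmx A *m (mu - mu_u)) - delta)%:E
            / (opnorm (invsqrtmx A *m sqrtmx A_u))%:E)%E)) :
  [/\ (L_c [set x : 'cV[R]_d | (delta < covnorm A (x - mu))%R]
       <= (d%:R / delta ^+ 2)%:E)%E,
      (L_u [set x : 'cV[R]_d | (covnorm A (x - mu) < delta)%R]
       <= (d%:R * opnorm (invsqrtmx A *m sqrtmx A_u) ^+ 2
           / (enorm (invsqrtmx A *m (mu_u - mu)) - delta) ^+ 2)%:E)%E &
      delta = enorm (invsqrtmx A *m (mu_u - mu))
              / (1 + opnorm (invsqrtmx A *m sqrtmx A_u)) ->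
      (L_u [set x : 'cV[R]_d | (covnorm A (x - mu) < delta)%R]
       <= (d%:R / delta ^+ 2)%:E)%E].
Proof.
case/andP: delta_range => d_delta delta_D.
have delta0 : 0 < delta by exact: le_lt_trans (sqrtr_ge0 _) d_delta.
have Apsd := covariance_matrix_psd L_c_mean_cov.
have Aupsd := covariance_matrix_psd L_u_mean_cov.
have [_ sqrtAu] := sqrtmxP Aupsd.
have [[sqrtAu_sym _] _] := sqrtmxP Aupsd.
set V := invsqrtmx A in gap delta_gap delta_D *.
set T := sqrtmx A_u in gap delta_gap sqrtAu sqrtAu_sym *.
have DE : enorm (V *m (mu_u - mu)) = enorm (V *m (mu - mu_u)).
  by rewrite -opprB mulmxN enormN.
rewrite DE; set D := enorm (V *m (mu - mu_u)) in delta_D DE gap delta_gap *.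
have covE (v : 'cV[R]_d) := invmx_formE v Apsd A_inv.
have cov0 (v : 'cV[R]_d) : 0 <= (v^T *m invmx A *m v) 0 0 by rewrite covE sqr_ge0.
have typeII : (L_u [set x : 'cV[R]_d | (covnorm A (x - mu) < delta)%R] <=
    (d%:R * opnorm (V *m T) ^+ 2 / (D - delta) ^+ 2)%:E)%E.
  have Dd : 0 < D - delta by rewrite subr_gt0.
  apply: le_trans (_ : (_ <= (\tr (invmx A *m A_u) / (D - delta) ^+ 2)%:E)%E) _.
    (* Markov's inequality is applied around [mu_u], the mean of [L_u], whereas the test is centered
       at [mu]. *)
    apply: le_trans (markov_quadratic_form L_u_mean_cov cov0 (exprn_gt0 2 Dd)).
    apply: le_measure; rewrite ?inE.
    (* The event is centered at [mu], so its measurability, which does not depend on the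
       probability, comes from [L_c]. *)
    - exact: measurable_ltr_set (measurable_covnorm L_c_mean_cov A) _.
    - apply: measurable_ler_set => //.
      exact: measurable_centered_form L_u_mean_cov (invmx A).
    - move=> x /=; rewrite /centered_form covE covnormE// => xd.
      rewrite lerXn2r ?nnegrE ?enorm_ge0 ?(ltW Dd)//.
      (* Triangle inequality: D <= |V (x - mu_u)| + |V (x - mu)|, and the last term is below
         [delta]. *)
      rewrite lerBlDr -DE.
      have -> : mu_u - mu = - (x - mu_u) + (x - mu) by rewrite opprB addrA subrK.
      by rewrite mulmxDr mulmxN (le_trans (ler_enormD _ _))// enormN lerD2l ltW.
  rewrite lee_fin ler_pM2r ?invr_gt0 ?exprn_gt0//.
  (* By cyclicity, tr(V V T T) = tr((V T) (T V)), and T V is the transpose of V T since both factors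
     are symmetric. *)
  rewrite (_ : \tr _ = \tr ((V *m T) *m (V *m T)^T)) ?frobenius_le_opnorm//.
  rewrite trmx_mul sqrtAu_sym invsqrtmx_sym// -invsqrtmx_sqr// -sqrtAu -mulmxA.
  by rewrite [LHS]mxtrace_mulC [RHS]mxtrace_mulC !mulmxA.
split=> //.
  apply: (@le_trans _ _
    (L_c [set x | (delta ^+ 2 <= centered_form mu (invmx A) x)%R])).
    apply: le_measure; rewrite ?inE.
    - exact: measurable_ltr_set (measurable_covnorm L_c_mean_cov A).
    - apply: measurable_ler_set => //.
      exact: measurable_centered_form L_c_mean_cov (invmx A).
    - move=> x /=; rewrite /centered_form covE covnormE// => dx.
      by rewrite lerXn2r ?nnegrE ?enorm_ge0// ltW.
  have := markov_quadratic_form L_c_mean_cov cov0 (exprn_gt0 2 delta0).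
  by rewrite mulVmx// mxtrace1.
move=> deltaE; apply: le_trans typeII _; rewrite lee_fin.
have o0 := opnorm_ge0 (V *m T).
set o := opnorm _ in deltaE o0 *.
(* Here D = delta (1 + o), so the factor o^2 cancels from the second bound. *)
have DdE : D - delta = delta * o.
  by rewrite deltaE; field; rewrite gt_eqF// ltr_wpDr.
(* If [o] were 0, then [delta] would equal [D], against delta < D. *)
have o_neq0 : o != 0.
  by apply: contraTneq delta_D => oz; rewrite -subr_gt0 DdE oz mulr0 ltxx.
by rewrite DdE exprMn -mulf_div divff ?mulr1 ?sqrf_eq0.
Qed.
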